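(* Consider the symmetric scalar two-player $\gamma$-discounted linear quadratic game, i.e. $\sigma_1=\sigma_2=\sigma>0$, with $a\neq0$, $\gamma\in(0,1]$, $r_1,r_2>0$. Let $(x_{\mathrm s},x_{\mathrm s})$, $(x_{\mathrm h_1},x_{\mathrm h_2})$, $(x_{\mathrm h_2},x_{\mathrm h_1})$ be, respectively, the symmetric and the two hyperbolic stable Feedback Nash Equilibria of the game, where $$x_{\mathrm h_1}=\frac{1-a^2\gamma-\sqrt{\Delta}}{2a\gamma},\qquad x_{\mathrm h_2}=\frac{1-a^2\gamma+\sqrt{\Delta}}{2a\gamma},\qquad \Delta=(\gamma a^2-1)^2-4\gamma^2\sigma a^2.$$ Then the ordering $$\min(x_{\mathrm h_1},x_{\mathrm h_2})<x_{\mathrm s}<\max(x_{\mathrm h_1},x_{\mathrm h_2})$$ holds, and for any initial state $s_0$ and each player $i$, $$V^{(i)}(s_0;x_{\mathrm h_2},x_{\mathrm h_1})\le V^{(i)}(s_0;x_{\mathrm s},x_{\mathrm s})\le V^{(i)}(s_0;x_{\mathrm h_1},x_{\mathrm h_2}),$$ where the first policy argument of $V^{(i)}$ is that of player $i$ and the second that of the other player.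
   Context: For a player index $i\in\{1,2\}$, $-i$ denotes the other player. The game: the scalar state evolves as $s_{t+1}=a s_t+u_{1,t}+u_{2,t}$, $t=0,1,2,\dots$, with $a\in\mathbb{R}$, and each player uses a linear feedback $u_{i,t}=x_i s_t$ with policy $x_i\in\mathbb{R}$. For $x=(x_1,x_2)$ put $a_{\mathrm{cl}}(x)=a+x_1+x_2$, so $s_t=a_{\mathrm{cl}}(x)^t s_0$. Player $i$'s value function is $$V^{(i)}(s_0;x_i,x_{-i})=\sum_{t=0}^\infty \gamma^t r_i(\sigma_i s_t^2+u_{i,t}^2)=s_0^2 r_i(\sigma_i+x_i^2)\sum_{t=0}^\infty(\gamma a_{\mathrm{cl}}^2(x))^t\in[0,\infty].$$ A pair $x^\star=(x_1^\star,x_2^\star)\in\mathbb{R}^2$ is a Feedback Nash Equilibrium (FNE) if for all $s_0\in\mathbb{R}$, each player $i$ and each $x_i\in\mathbb{R}$, $V^{(i)}(s_0;x_i^\star,x_{-i}^\star)\le V^{(i)}(s_0;x_i,x_{-i}^\star)$. It is a stable FNE if in addition $|a_{\mathrm{cl}}(x^\star)|<1$. In the symmetric game, an FNE $(x_i,x_{-i})$ is called symmetric if $x_i=x_{-i}$ and hyperbolic if $x_i=\sigma/x_{-i}$; the claim concerns games in which the symmetric stable FNE and the two (distinct) hyperbolic stable FNE all exist. *)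

(* Defs.v *)
From HB Require Import structures.
From mathcomp Require Import all_boot all_order all_algebra.
From mathcomp Require Import all_classical all_reals all_analysis.
Set Implicit Arguments.
Unset Strict Implicit.
Unset Printing Implicit Defensive.
Import Order.TTheory GRing.Theory Num.Theory.
Local Open Scope ring_scope.

(* The players 1, 2 are the two elements of 'I_2, and the opponent -i of
   player i is rev_ord i. *)
Record lq_game (R : realType) := LQGame {
  dynamics : R;
  discount : R;
  weight : 'I_2 -> R;
  scaling : 'I_2 -> R
}.

Definition policies (R : realType) (i : 'I_2) (xi xopp : R) : 'I_2 -> R :=
  fun j => if j == i then xi else xopp.

Fixpoint state (R : realType) (G : lq_game R) (x : 'I_2 -> R) (s0 : R)
    (t : nat) : R :=
  match t with
  | O => s0
  | S t' => dynamics G * state G x s0 t' + \sum_(i < 2) x i * state G x s0 t'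
  end.

Definition control (R : realType) (G : lq_game R) (x : 'I_2 -> R) (s0 : R)
    (i : 'I_2) (t : nat) : R := x i * state G x s0 t.

Definition closed_loop (R : realType) (G : lq_game R) (x : 'I_2 -> R) : R :=
  dynamics G + \sum_(i < 2) x i.

(* The sum is taken in \bar R, so that a divergent cost has value +oo. *)
Definition value (R : realType) (G : lq_game R) (i : 'I_2)
    (s0 xi xopp : R) : \bar R :=
  let x := policies i xi xopp in
  (\sum_(0 <= t <oo)
     (discount G ^+ t *
        (scaling G i *
           (weight G i * state G x s0 t ^+ 2 + control G x s0 i t ^+ 2)))%:E)%E.

Definition FNE (R : realType) (G : lq_game R) (x : 'I_2 -> R) : Prop :=
  forall (s0 : R) (i : 'I_2) (xi : R),
    (value G i s0 (x i) (x (rev_ord i)) <= value G i s0 xi (x (rev_ord i)))%E.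

Definition stable_FNE (R : realType) (G : lq_game R) (x : 'I_2 -> R) : Prop :=
  FNE G x /\ `|closed_loop G x| < 1.

Definition symmetric (R : realType) (x : 'I_2 -> R) : Prop :=
  forall i : 'I_2, x i = x (rev_ord i).

(* Since sigma / 0 = 0 here, the denominator has to be required nonzero. *)
Definition hyperbolic (R : realType) (sigma : R) (x : 'I_2 -> R) : Prop :=
  forall i : 'I_2, x (rev_ord i) != 0 /\ x i = sigma / x (rev_ord i).

Definition symmetric_stable_FNE (R : realType) (G : lq_game R)
    (x : 'I_2 -> R) : Prop := stable_FNE G x /\ symmetric x.

Definition hyperbolic_stable_FNE (R : realType) (G : lq_game R) (sigma : R)
    (x : 'I_2 -> R) : Prop := stable_FNE G x /\ hyperbolic sigma x.

(* Main.v *)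
Require Import Defs.
From HB Require Import structures.
From mathcomp Require Import all_boot all_order all_algebra.
From mathcomp Require Import all_classical all_reals all_analysis.
From mathcomp Require Import ring lra.
Set Implicit Arguments.
Unset Strict Implicit.
Unset Printing Implicit Defensive.
Import Order.TTheory GRing.Theory Num.Theory.
Local Open Scope ring_scope.

(** When [gamma * c ^ 2 < 1], with [c] the closed-loop gain, the discounted cost
is a geometric series, and a player using [x] pays
[s0 ^ 2 * r * (sigma + x ^ 2) / (1 - gamma * c ^ 2)] ([value_geometric]).

A hyperbolic pair has [xh1 * xh2 = sigma] and closed-loop gain
[1 / (gamma * a)], so the quotient collapses to [- a * x]
([quadratic_cost_hyperbolic]): at these equilibria the cost of a player is
linear in that player's own policy.  At a symmetric equilibrium the first-order
condition of the best response ([symmetric_FNE_stationary]) turns the quotient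
into [- xs / (gamma * cs)], with [cs] the symmetric closed-loop gain.

Multiplying policies by [- gamma * a] removes the dependence on the sign of
[a].  In the variables [A, B = - gamma * a * xh1, - gamma * a * xh2],
[Y = - gamma * a * xs], [p = gamma * a ^ 2] and [q = gamma * a * cs], the three
costs are proportional to [A], [Y / q] and [B], and the theorem becomes
[B < Y < A] and [B <= Y / q <= A].  What decides both is [1 < q]
([symmetric_gain_gt1]): the symmetric equilibrium contracts more slowly than
the hyperbolic ones.  This holds because the symmetric first-order condition,
as a cubic in [q], is increasing on [q ^ 2 < p] and equals [- (A - B) ^ 2] at
the hyperbolic gain [q = 1].  Given [1 < q], the position of [Y] and of [Y / q]
with respect to the roots [A] and [B] of the hyperbolic quadratic is read off
from the factored values of that quadratic ([symmetric_between] and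
[symmetric_cost_between]). *)

(** * Costs as geometric series *)

Lemma sum_policies (R : realType) (i : 'I_2) (x y : R) :
  \sum_(j < 2) policies i x y j = x + y.
Proof.
rewrite !big_ord_recl big_ord0 /policies addr0.
by case: i => -[|[|//]] ? /=; rewrite // addrC.
Qed.

Lemma stateE (R : realType) (G : lq_game R) (x : 'I_2 -> R) (s0 : R) t :
  state G x s0 t = closed_loop G x ^+ t * s0.
Proof.
elim: t => [|t IH] /=; first by rewrite expr0 mul1r.
by rewrite -mulr_suml -mulrDl IH exprS mulrA.
Qed.

Definition quadratic_cost (R : realType) (gamma sigma x c : R) : R :=
  (sigma + x ^+ 2) / (1 - gamma * c ^+ 2).

Lemma value_geometric (R : realType) (G : lq_game R) (i : 'I_2) (s0 x y : R) :
  let c := dynamics G + (x + y) in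
  0 <= discount G -> discount G * c ^+ 2 < 1 ->
  value G i s0 x y =
    (s0 ^+ 2 * scaling G i * quadratic_cost (discount G) (weight G i) x c)%:E.
Proof.
move=> c g0 gc1; rewrite /value.
set k := s0 ^+ 2 * scaling G i * (weight G i + x ^+ 2).
have term t : discount G ^+ t *
    (scaling G i * (weight G i * state G (policies i x y) s0 t ^+ 2 +
      control G (policies i x y) s0 i t ^+ 2)) =
    geometric k (discount G * c ^+ 2) t.
  rewrite /= /control stateE /closed_loop sum_policies -/c.
  have -> : policies i x y i = x by rewrite /policies eqxx.
  have -> : (discount G * c ^+ 2) ^+ t = discount G ^+ t * (c ^+ t) ^+ 2.
    by rewrite exprMn -!exprM mulnC.
  by rewrite /k; ring.
under eq_eseriesr do rewrite term.
apply: cvg_lim => //.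
under eq_fun do rewrite sumEFin.
apply: cvg_EFin; first by near=> n.
rewrite /quadratic_cost mulrA -/k; apply: cvg_geometric_series.
by rewrite ger0_norm // mulr_ge0 // sqr_ge0.
Unshelve. all: by end_near. Qed.

Lemma discounted_gain_lt1 (R : realType) (gamma c : R) :
  0 < gamma -> gamma <= 1 -> `|c| < 1 -> gamma * c ^+ 2 < 1.
Proof.
move=> g0 g1 c1.
have c21 : c ^+ 2 < 1 by rewrite -real_normK ?num_real // expr_lt1.
by apply: le_lt_trans c21; rewrite ler_piMl // sqr_ge0.
Qed.

(** * First-order condition of a best response *)

(** Clearing denominators in the optimality of [x] gives
[0 <= 2 e L + e ^ 2 K] for the deviation [x + e], where [L] is the left-hand
side of the conclusion and [K > 0].  Deviations with infinite cost satisfy this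
too, their denominator being nonpositive, so no smallness of [e] is at stake
and [e = - L / K] gives [L = 0]. *)
Lemma best_response_stationary (R : realType) (gamma sigma b x : R) :
  0 < gamma -> 0 < sigma -> gamma * (b + x) ^+ 2 < 1 ->
  (forall z, gamma * (b + z) ^+ 2 < 1 ->
     quadratic_cost gamma sigma x (b + x) <=
     quadratic_cost gamma sigma z (b + z)) ->
  x * (1 - gamma * (b + x) ^+ 2) + gamma * (b + x) * (sigma + x ^+ 2) = 0.
Proof.
move=> g0 s0 gc1 opt.
set L := LHS.
set K := (1 - gamma * (b + x) ^+ 2) + gamma * (sigma + x ^+ 2).
have N_gt0 z : 0 < sigma + z ^+ 2 by rewrite ltr_wpDr // sqr_ge0.
have K_gt0 : 0 < K by rewrite addr_gt0 ?subr_gt0 // mulr_gt0.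
have cross z : (sigma + x ^+ 2) * (1 - gamma * (b + z) ^+ 2) <=
               (sigma + z ^+ 2) * (1 - gamma * (b + x) ^+ 2).
  have [gz1|gz1] := ltP (gamma * (b + z) ^+ 2) 1.
    have := opt z gz1; rewrite /quadratic_cost ler_pdivrMr ?subr_gt0 //.
    by rewrite mulrAC ler_pdivlMr ?subr_gt0.
  apply: (@le_trans _ _ 0).
    by rewrite mulr_ge0_le0 ?subr_le0 // ltW.
  by rewrite mulr_ge0 ?subr_ge0 // ltW.
have quad e : 0 <= 2 * e * L + e ^+ 2 * K.
  have := cross (x + e); rewrite -subr_ge0; congr (0 <= _).
  by rewrite /L /K; ring.
have := quad (- L / K).
have -> : 2 * (- L / K) * L + (- L / K) ^+ 2 * K = - (L ^+ 2 / K).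
  by field; rewrite gt_eqF.
rewrite oppr_ge0 pmulr_lle0 ?invr_gt0 // => L2.
by apply/eqP; rewrite -sqrf_eq0 eq_le L2 sqr_ge0.
Qed.

Lemma symmetric_FNE_stationary (R : realType) (a gamma sigma xs : R)
    (r : 'I_2 -> R) (G := LQGame a gamma (fun=> sigma) r)
    (c := a + (xs + xs)) :
  0 < gamma -> 0 < sigma -> 0 < r ord0 -> gamma * c ^+ 2 < 1 ->
  FNE G (policies ord0 xs xs) ->
  xs * (1 - gamma * c ^+ 2) + gamma * c * (sigma + xs ^+ 2) = 0.
Proof.
move=> g0 s0 r0 gc1 fne.
have cE z : a + (z + xs) = a + xs + z by ring.
rewrite /c cE in gc1 *.
apply: best_response_stationary => // z gz1.
have := fne 1 ord0 z.
rewrite /policies eqxx /= !value_geometric /= ?cE //; try exact: ltW.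
by rewrite expr1n mul1r lee_fin ler_pM2l.
Qed.

(** The factor [sigma + x ^ 2] is [x * (x + y)], and both [x + y] and
[1 - gamma * c ^ 2] are determined by [gamma * a * c = 1]. *)
Lemma quadratic_cost_hyperbolic (R : realType) (a gamma sigma x y : R)
    (c := a + (x + y)) :
  0 < gamma -> a != 0 -> gamma * a * c = 1 -> gamma * c ^+ 2 < 1 ->
  sigma = x * y -> quadratic_cost gamma sigma x c = - a * x.
Proof.
move=> g0 a0 gac gc1 ->; rewrite /quadratic_cost.
have D0 : 1 - gamma * c ^+ 2 != 0 by rewrite gt_eqF // subr_gt0.
apply: (mulIf D0); rewrite divfK //.
have -> : y = c - a - x by rewrite /c; ring.
have -> : - a * x * (1 - gamma * c ^+ 2) = - a * x + x * c * (gamma * a * c).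
  by ring.
by rewrite gac; ring.
Qed.

(** * Ordering of the normalised equilibria *)

Section NormalisedEquilibria.
Variables (R : realType) (p q A B Y : R).
Hypotheses (p_gt1 : 1 < p) (q2_lt : q ^+ 2 < p) (AB_gt0 : 0 < A * B)
  (ltBA : B < A) (sumAB : A + B = p - 1) (YE : 2 * Y = p - q)
  (stationary : Y * (p - q ^+ 2) = q * (A * B + Y ^+ 2)).

(** By stationarity [Y] and [q] have the same sign, and [2 Y + q = p > 0]. *)
Lemma symmetric_signs : 0 < q /\ 0 < Y.
Proof.
have D0 : 0 < p - q ^+ 2 by rewrite subr_gt0.
have N0 : 0 < A * B + Y ^+ 2 by rewrite ltr_wpDr // sqr_ge0.
have q0 : 0 < q.
  rewrite ltNge; apply/negP => q_le0.
  have Y_le0 : Y <= 0.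
    by rewrite -(pmulr_lle0 _ D0) stationary mulr_le0_ge0 // ltW.
  have := p_gt1; have := YE; lra.
by split=> //; rewrite -(pmulr_lgt0 _ D0) stationary mulr_gt0.
Qed.

(** Substituting [Y = (p - q) / 2] turns stationarity into the vanishing of a
cubic in [q] whose value at [1] is [- (A - B) ^ 2].  In [cubic] below, its
increment from [1] to [q] is factored as [q - 1] times a secant slope, and that
slope is positive since [q] and [q ^ 2] lie below [p] and [1 < p]. *)
Lemma symmetric_gain_gt1 : 1 < q.
Proof.
have [q0 Y0] := symmetric_signs.
have cubic : (q - 1) * (2 * p + 4 * (A * B) + p ^+ 2 - (q ^+ 2 + q + 1)) =
             (A - B) ^+ 2.
  have BE : B = p - 1 - A by have := sumAB; lra.
  have pE : p = q + 2 * Y by have := YE; lra.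
  have /eqP := stationary; rewrite -subr_eq0 => /eqP st0.
  apply/eqP; rewrite -subr_eq0; apply/eqP.
  have -> : (q - 1) * (2 * p + 4 * (A * B) + p ^+ 2 - (q ^+ 2 + q + 1)) -
    (A - B) ^+ 2 = - 4 * (Y * (p - q ^+ 2) - q * (A * B + Y ^+ 2)).
    by rewrite BE pE; ring.
  by rewrite st0 mulr0.
have slope : 0 < 2 * p + 4 * (A * B) + p ^+ 2 - (q ^+ 2 + q + 1).
  have ltqp : q < p by have := YE; lra.
  have p_ltp2 : p * 1 < p * p by rewrite ltr_pM2l // (lt_trans _ p_gt1).
  rewrite -expr2 mulr1 in p_ltp2.
  have := q2_lt; have := AB_gt0; have := p_gt1; lra.
rewrite -subr_gt0 -(pmulr_lgt0 _ slope) cubic exprn_even_gt0 //=.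
by rewrite subr_eq0 gt_eqF.
Qed.

Lemma between_roots (y : R) : (y - A) * (y - B) < 0 -> B < y /\ y < A.
Proof.
move=> neg; split; rewrite ltNge; apply/negP => le_y.
  suff : 0 <= (y - A) * (y - B) by rewrite leNgt neg.
  by rewrite mulr_le0 // subr_le0 // (le_trans le_y) // ltW.
suff : 0 <= (y - A) * (y - B) by rewrite leNgt neg.
by rewrite mulr_ge0 // subr_ge0 // (le_trans _ le_y) // ltW.
Qed.

(** Stationarity eliminates [A * B] from the hyperbolic quadratic at [Y], which
then factors as [Y * (p + q) * (1 - q) / q]. *)
Lemma symmetric_between : B < Y /\ Y < A.
Proof.
have [q0 Y0] := symmetric_signs; have q1 := symmetric_gain_gt1.
apply: between_roots; rewrite -(pmulr_rlt0 _ q0).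
have -> : q * ((Y - A) * (Y - B)) =
          q * (A * B + Y ^+ 2) - q * Y * (A + B) by ring.
rewrite -stationary sumAB.
have -> : Y * (p - q ^+ 2) - q * Y * (p - 1) = Y * (p + q) * (1 - q) by ring.
rewrite pmulr_rlt0 ?subr_lt0 // mulr_gt0 // addr_gt0 //.
exact: lt_trans p_gt1.
Qed.

(** The same elimination at [Y / q] leaves
[Y * (Y + q) * (1 - q ^ 2) / q ^ 2]. *)
Lemma symmetric_cost_between : B < Y / q /\ Y / q < A.
Proof.
have [q0 Y0] := symmetric_signs; have q1 := symmetric_gain_gt1.
have qn0 : q != 0 by rewrite gt_eqF.
apply: between_roots; rewrite -(pmulr_rlt0 _ (exprn_gt0 2 q0)).
have -> : q ^+ 2 * ((Y / q - A) * (Y / q - B)) =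
          Y ^+ 2 * (1 - q ^+ 2) - q * Y * (A + B) + q * (q * (A * B + Y ^+ 2)).
  by field.
rewrite -stationary sumAB.
have -> : Y ^+ 2 * (1 - q ^+ 2) - q * Y * (p - 1) + q * (Y * (p - q ^+ 2)) =
          Y * (Y + q) * (1 - q ^+ 2) by ring.
by rewrite pmulr_rlt0 ?subr_lt0 ?mulr_gt0 ?addr_gt0 // expr_gt1 // ltW.
Qed.

End NormalisedEquilibria.

(** * Comparison of the three equilibria *)

Theorem theorem6p1 (R : realType) (a gamma sigma : R) (r : 'I_2 -> R)
    (G : lq_game R) (Delta xs xh1 xh2 : R)
    (G_def : G = LQGame a gamma (fun=> sigma) r)
    (sigma_gt0 : 0 < sigma) (a_neq0 : a != 0)
    (gamma_gt0 : 0 < gamma) (gamma_le1 : gamma <= 1)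
    (r_gt0 : forall i : 'I_2, 0 < r i)
    (Delta_def :
      Delta = (gamma * a ^+ 2 - 1) ^+ 2 - 4 * gamma ^+ 2 * sigma * a ^+ 2)
    (xh1_def :
      xh1 = (1 - a ^+ 2 * gamma - Num.sqrt Delta) / (2 * a * gamma))
    (xh2_def :
      xh2 = (1 - a ^+ 2 * gamma + Num.sqrt Delta) / (2 * a * gamma))
    (xs_FNE : symmetric_stable_FNE G (policies ord0 xs xs))
    (xh12_FNE : hyperbolic_stable_FNE G sigma (policies ord0 xh1 xh2))
    (xh21_FNE : hyperbolic_stable_FNE G sigma (policies ord0 xh2 xh1))
    (xh_distinct : xh1 != xh2) :
  (Num.min xh1 xh2 < xs /\ xs < Num.max xh1 xh2) /\
  forall (s0 : R) (i : 'I_2),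
    (value G i s0 xh2 xh1 <= value G i s0 xs xs)%E /\
    (value G i s0 xs xs <= value G i s0 xh1 xh2)%E.
Proof.
subst G.
have [[fne_s stab_s] _] := xs_FNE.
have [[_ stab_h] hyp] := xh12_FNE.
rewrite /closed_loop !sum_policies /= in stab_s stab_h.
set cs := a + (xs + xs) in stab_s.
set ch := a + (xh1 + xh2) in stab_h.
have g0 : gamma != 0 by rewrite gt_eqF.
have gcs := discounted_gain_lt1 gamma_gt0 gamma_le1 stab_s.
have gch := discounted_gain_lt1 gamma_gt0 gamma_le1 stab_h.
have stat : xs * (1 - gamma * cs ^+ 2) + gamma * cs * (sigma + xs ^+ 2) = 0.
  exact: symmetric_FNE_stationary fne_s.
have prod : sigma = xh1 * xh2.
  have [] := hyp ord0; rewrite /policies /= => h2 ->.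
  by rewrite divfK.
have gach : gamma * a * ch = 1.
  by rewrite /ch xh1_def xh2_def; field; rewrite g0 a_neq0.
have a2_gt0 : 0 < a ^+ 2 by rewrite exprn_even_gt0.
pose p := gamma * a ^+ 2; pose q := gamma * a * cs.
pose A := - (gamma * a) * xh1; pose B := - (gamma * a) * xh2.
pose Y := - (gamma * a) * xs.
have p_gt0 : 0 < p by rewrite mulr_gt0.
(* Since [gamma * ch ^ 2 = 1 / p], this is stability at the hyperbolic gain. *)
have p_gt1 : 1 < p.
  have -> : 1 = p * (gamma * ch ^+ 2) by rewrite -(expr1n _ 2) -gach /p; ring.
  by rewrite gtr_pMr.
have q2_lt : q ^+ 2 < p.
  have -> : q ^+ 2 = p * (gamma * cs ^+ 2) by rewrite /q /p; ring.
  by rewrite gtr_pMr.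
have ABE : A * B = gamma * p * sigma by rewrite prod /A /B /p; ring.
have AB_gt0 : 0 < A * B.
  by rewrite ABE; apply: mulr_gt0 => //; exact: mulr_gt0.
have ltBA : B < A.
  have AsubB : A - B = Num.sqrt Delta.
    by rewrite /A /B xh1_def xh2_def; field; rewrite g0 a_neq0.
  rewrite lt_neqAle -subr_ge0 AsubB sqrtr_ge0 andbT.
  apply: contra_neq xh_distinct => /mulfI -> //.
  by rewrite oppr_eq0 mulf_neq0.
have sumAB : A + B = p - 1 by rewrite -gach /A /B /p /ch; ring.
have YE : 2 * Y = p - q by rewrite /Y /p /q /cs; ring.
have statY : Y * (p - q ^+ 2) = q * (A * B + Y ^+ 2).
  apply/eqP; rewrite -subr_eq0 ABE.
  have -> : Y * (p - q ^+ 2) - q * (gamma * p * sigma + Y ^+ 2) =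
    - (gamma * a) * p *
    (xs * (1 - gamma * cs ^+ 2) + gamma * cs * (sigma + xs ^+ 2)).
    by rewrite /Y /p /q; ring.
  by rewrite stat mulr0.
have [q_gt0 _] := symmetric_signs p_gt1 q2_lt AB_gt0 YE statY.
have [BY YA] := symmetric_between p_gt1 q2_lt AB_gt0 ltBA sumAB YE statY.
have [BYq YqA] :=
  symmetric_cost_between p_gt1 q2_lt AB_gt0 ltBA sumAB YE statY.
split.
  rewrite gt_min lt_max.
  have [a_lt0|a_gt0|a0] := ltgtP a 0; last by rewrite a0 eqxx in a_neq0.
    have k_gt0 : 0 < - (gamma * a) by rewrite oppr_gt0 pmulr_rlt0.
    move: BY YA; rewrite /A /B /Y !ltr_pM2l // => -> ->.
    by rewrite orbT.
  have k_lt0 : - (gamma * a) < 0 by rewrite oppr_lt0 mulr_gt0.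
  move: BY YA; rewrite /A /B /Y !ltr_nM2l // => -> ->.
  by rewrite orbT.
move=> s0 i.
have chC : a + (xh2 + xh1) = ch by rewrite (addrC xh2).
have cost1 : quadratic_cost gamma sigma xh1 ch = A / gamma.
  by rewrite quadratic_cost_hyperbolic // /A; field.
have cost2 : quadratic_cost gamma sigma xh2 ch = B / gamma.
  rewrite -chC quadratic_cost_hyperbolic ?chC //; first by rewrite /B; field.
  by rewrite prod mulrC.
have costs : quadratic_cost gamma sigma xs cs = (Y / q) / gamma.
  have cs0 : cs != 0.
    by apply: contraTneq q_gt0; rewrite /q => ->; rewrite mulr0 ltxx.
  have D0 : 1 - gamma * cs ^+ 2 != 0 by rewrite gt_eqF // subr_gt0.
  have gcs0 : gamma * cs != 0 by rewrite mulf_neq0.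
  apply: (mulIf D0); rewrite divfK //; apply: (mulfI gcs0).
  move/eqP: stat; rewrite addrC addr_eq0 => /eqP ->.
  by rewrite /Y /q; field; rewrite g0 cs0 a_neq0.
have scale u v : u <= v ->
    s0 ^+ 2 * r i * (u / gamma) <= s0 ^+ 2 * r i * (v / gamma).
  move=> uv; apply: ler_wpM2l; first by rewrite mulr_ge0 ?sqr_ge0 // ltW.
  by rewrite ler_pM2r // invr_gt0.
rewrite !value_geometric /= ?chC //; try exact: ltW.
by rewrite cost1 cost2 costs !lee_fin; split; apply/scale/ltW.
Qed.
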